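(* Suppose $\|\mathbf d\|<\|\mathbf a\|=1$. Let $\Gamma:D^m\to D^n$ be such that $C_\Gamma$ is a full-dimensional maximal $Q_h$-free set. Then $C^G_\Gamma\cap H$ is a full-dimensional maximal $Q_g$-free set if and only if $G=D^m$.
   Context: Fix integers $n,m\ge 1$ and $(\mathbf a,\mathbf d)\in\mathbb R^n\times\mathbb R^m$ with $\max\{\|\mathbf a\|,\|\mathbf d\|\}=1$, where $\|\cdot\|$ is the Euclidean norm. Define $Q_h=\{(\mathbf x,\mathbf y)\in\mathbb R^n\times\mathbb R^m:\|\mathbf x\|\le\|\mathbf y\|\}$, $H=\{(\mathbf x,\mathbf y)\in\mathbb R^n\times\mathbb R^m:\mathbf a^\top\mathbf x+\mathbf d^\top\mathbf y=-1\}$, and $Q_g=Q_h\cap H$. A closed convex set $C\subseteq\mathbb R^n\times\mathbb R^m$ is $Q_h$-free if its interior is disjoint from $Q_h$; it is maximal $Q_h$-free if it is $Q_h$-free and not a strict subset of another $Q_h$-free set; it is full-dimensional if it has dimension $n+m$. A set $K\subseteq H$ is full-dimensional if it has dimension $n+m-1$. A full-dimensional closed convex set $K\subseteq H$ is $Q_g$-free if its relative interior is disjoint from $Q_g$; it is maximal $Q_g$-free if it is $Q_g$-free and not a strict subset of another $Q_g$-free set contained in $H$. Let $D^k=\{\mathbf x\in\mathbb R^k:\|\mathbf x\|=1\}$. For $\Gamma:D^m\to D^n$ and $I\subseteq D^m$, let $C^I_\Gamma=\{(\mathbf x,\mathbf y)\in\mathbb R^n\times\mathbb R^m: -\Gamma(\boldsymbol\beta)^\top\mathbf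 x+\boldsymbol\beta^\top\mathbf y\le 0\ \ \forall\,\boldsymbol\beta\in I\}$, $C_\Gamma=C^{D^m}_\Gamma$, and $G=G(\Gamma,\mathbf a,\mathbf d)=\{\boldsymbol\beta\in D^m:\mathbf a^\top\Gamma(\boldsymbol\beta)+\mathbf d^\top\boldsymbol\beta\le 0\}$. *)

(* Defs.v *)
From HB Require Import structures.
From mathcomp Require Import all_boot all_order all_algebra.
From mathcomp Require Import all_classical all_reals all_analysis.

Set Implicit Arguments.
Unset Strict Implicit.
Unset Printing Implicit Defensive.

Import Order.TTheory GRing.Theory Num.Theory.
Import numFieldNormedType.Exports.

Local Open Scope classical_set_scope.
Local Open Scope ring_scope.

(* The norm `|_| of the library on matrices and pairs is the max norm; it only
   provides the topology below.  Euclidean lengths are written [enorm]. *)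
Notation prodspace R n m := ('cV[R]_n * 'cV[R]_m)%type.

Section Euclidean.
Context {R : realType} {k : nat}.
Implicit Types u v : 'cV[R]_k.

Definition dot u v : R := (u^T *m v) 0 0.

Definition enorm u : R := Num.sqrt (dot u u).

End Euclidean.

Definition sphere (R : realType) (k : nat) : set 'cV[R]_k :=
  [set x | enorm x = 1].
Arguments sphere R k : clear implicits.

Definition aff_hull (R : realType) (V : lmodType R) (S : set V) : set V :=
  [set x | exists (k : nat) (t : 'I_k -> R) (s : 'I_k -> V),
    [/\ forall i, S (s i), \sum_i t i = 1 & x = \sum_i t i *: s i]].

(* The affine hull of [S] is [x0 + U] with [\dim U = k]; in particular [S] is
   nonempty. *)
Definition has_dim (R : realType) (V : vectType R) (S : set V) (k : nat) :
    Prop :=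
  exists (x0 : V) (U : {vspace V}),
    aff_hull S = [set x | x - x0 \in U] /\ \dim U = k.

Section Free.
Context {R : realType} {n m : nat}.
Implicit Types (C K : set (prodspace R n m)) (a : 'cV[R]_n) (d : 'cV[R]_m).

Definition relint K : set (prodspace R n m) :=
  [set p | K p /\ \forall q \near p, aff_hull K q -> K q].

Definition Qh : set (prodspace R n m) := [set p | enorm p.1 <= enorm p.2].

Definition Hplane a d : set (prodspace R n m) :=
  [set p | dot a p.1 + dot d p.2 = -1].

Definition Qg a d : set (prodspace R n m) := Qh `&` Hplane a d.

Definition Qh_free C : Prop :=
  [/\ closed C, convex_set C & C° `&` Qh = set0].

Definition maximal_Qh_free C : Prop :=
  Qh_free C /\ forall C', Qh_free C' -> ~ C `<` C'.

Definition full_dim C : Prop := has_dim C (n + m)%N.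

Definition full_dim_in_H K : Prop := has_dim K (n + m - 1)%N.

Definition Qg_free a d K : Prop :=
  [/\ K `<=` Hplane a d, full_dim_in_H K, closed K, convex_set K &
      relint K `&` Qg a d = set0].

Definition maximal_Qg_free a d K : Prop :=
  Qg_free a d K /\ forall K', Qg_free a d K' -> ~ K `<` K'.

(* A map D^m -> D^n is encoded as a total [Gamma]; its values off [sphere R m]
   do not matter as long as [I] is contained in [sphere R m]. *)
Definition CGamma (Gamma : 'cV[R]_m -> 'cV[R]_n) (I : set 'cV[R]_m) :
    set (prodspace R n m) :=
  [set p | forall b, I b -> - dot (Gamma b) p.1 + dot b p.2 <= 0].

Definition Gset (Gamma : 'cV[R]_m -> 'cV[R]_n) a d : set 'cV[R]_m :=
  [set b | sphere R m b /\ dot a (Gamma b) + dot d b <= 0].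

End Free.

(* Main.v *)
From HB Require Import structures.
Require Import Defs.
From mathcomp Require Import all_boot all_order all_algebra.
From mathcomp Require Import all_classical all_reals all_analysis.
From mathcomp Require Import ring lra.

Import Order.TTheory GRing.Theory Num.Theory.
Import numFieldNormedType.Exports.

Local Open Scope classical_set_scope.
Local Open Scope ring_scope.

(* Write q(x, y) = |x|^2 - |y|^2, v_b = (Gamma b, b), A = (a, d), and call
   <(-Gamma b, b), p> <= 0 the cut of b.  Maximality of C_Gamma forces Gamma to
   be nonexpansive, that is, v_b lies in C_Gamma for every b.

   If <A, v_b0> > 0 for some b0, the q-orthogonal projection of v_b0 onto the
   hyperplane <A, _> = 0 (which exists because q(a, -d) = 1 - |d|^2 > 0)
   satisfies the cuts of G and has q < 0; it is a recession direction along
   which the relative interior of C^G_Gamma /\ H meets Q_g.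

   If G = D^m, then (-a, d) lies in C_Gamma, so H meets the interior of C_Gamma;
   a point z violating the cut of b makes q decrease from 0 when v_b is pushed
   towards z, so no larger set is Q_g-free. *)

Set Implicit Arguments.
Unset Strict Implicit.
Unset Printing Implicit Defensive.

(** * Dot product and Euclidean norm on column vectors *)

Section Dot.
Context {R : realType} {k : nat}.
Implicit Types u v w : 'cV[R]_k.

Lemma dotE u v : dot u v = \sum_i u i 0 * v i 0.
Proof. by rewrite /dot mxE; apply: eq_bigr => i _; rewrite mxE. Qed.

Lemma dotC u v : dot u v = dot v u.
Proof. by rewrite !dotE; apply: eq_bigr => i _; rewrite mulrC. Qed.

Lemma dotDl u v w : dot (u + v) w = dot u w + dot v w.
Proof. by rewrite /dot linearD mulmxDl mxE. Qed.

Lemma dotZl t u v : dot (t *: u) v = t * dot u v.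
Proof. by rewrite /dot linearZ -scalemxAl mxE. Qed.

Lemma dotNl u v : dot (- u) v = - dot u v.
Proof. by rewrite -scaleN1r dotZl mulN1r. Qed.

Lemma dotDr u v w : dot w (u + v) = dot w u + dot w v.
Proof. by rewrite dotC dotDl ![dot _ w]dotC. Qed.

Lemma dotZr t u v : dot v (t *: u) = t * dot v u.
Proof. by rewrite dotC dotZl dotC. Qed.

Lemma dotNr u v : dot v (- u) = - dot v u.
Proof. by rewrite dotC dotNl dotC. Qed.

Definition dot_lin := (dotDl, dotDr, dotZl, dotZr, dotNl, dotNr).

Lemma dot_ge0 u : 0 <= dot u u.
Proof. by rewrite dotE sumr_ge0// => i _; rewrite -expr2 sqr_ge0. Qed.

Lemma dot_eq0 u : dot u u = 0 -> u = 0.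
Proof.
rewrite dotE => /psumr_eq0P u0; apply/matrixP => i j; rewrite ord1 mxE.
apply/eqP; rewrite -(sqrf_eq0 (u i 0)) expr2; apply/eqP/u0 => //.
by move=> l _; rewrite -expr2 sqr_ge0.
Qed.

Lemma sqr_enorm u : enorm u ^+ 2 = dot u u.
Proof. exact/sqr_sqrtr/dot_ge0. Qed.

Lemma enorm_ge0 u : 0 <= enorm u.
Proof. exact: sqrtr_ge0. Qed.

Lemma sphere_dot u : sphere R k u <-> dot u u = 1.
Proof.
rewrite -sqr_enorm /sphere/=; split => [->|/eqP]; first by rewrite expr1n.
by rewrite sqrp_eq1 ?enorm_ge0// => /eqP.
Qed.

Lemma dot_le_enorm u v : dot u v <= enorm u * enorm v.
Proof.
have [v0|v0] := eqVneq (dot v v) 0.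
  by rewrite (dot_eq0 v0) -(scale0r 0) dotZr mul0r mulr_ge0 ?enorm_ge0.
have vv : 0 < dot v v by rewrite lt_neqAle eq_sym v0 dot_ge0.
have := dot_ge0 (dot v v *: u - dot u v *: v); rewrite !dot_lin (dotC v u).
set x := dot u v; set y := dot v v; set z := dot u u => h.
have xyz : x ^+ 2 <= z * y.
  rewrite -subr_ge0 -(pmulr_rge0 _ vv) -/y; move: h; congr (0 <= _); ring.
have zy : 0 <= enorm u * enorm v by rewrite mulr_ge0 ?enorm_ge0.
have [|x0] := leP x 0; first by move/le_trans; exact.
by rewrite -ler_sqr ?nnegrE// ?(ltW x0)// exprMn !sqr_enorm.
Qed.

Lemma coord_le1 u i : dot u u = 1 -> `|u i 0| <= 1.
Proof.
move=> u1; rewrite -[leRHS]normr1 -ler_sqr ?nnegrE// -!normrX.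
rewrite !ger0_norm ?sqr_ge0// expr1n -u1 dotE (bigD1 i)//= -expr2 lerDl.
by rewrite sumr_ge0// => j _; rewrite -expr2 sqr_ge0.
Qed.

(** Coordinates of a unit vector are at most 1 in absolute value, so each dominates its own
    square. *)
Lemma sum_norm_unit_ge1 u : dot u u = 1 -> 1 <= \sum_i `|u i 0|.
Proof.
move=> u1; rewrite -[leLHS]u1 dotE ler_sum// => i _.
rewrite -expr2 -real_normK ?num_real// expr2 ler_piMl// coord_le1//.
Qed.

Lemma coord_le_norm u i : `|u i 0| <= `|u|.
Proof.
rewrite [leRHS]/Num.norm/= mx_normrE.
exact: (le_bigmax _ (fun ij : 'I_k * 'I_1 => `|u ij.1 ij.2|) (i, 0)).
Qed.

Lemma dot_le_norm u v : dot u v <= (\sum_i `|u i 0|) * `|v|.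
Proof.
rewrite dotE mulr_suml ler_sum// => i _; apply: le_trans (ler_norm _) _.
by rewrite normrM ler_wpM2l// coord_le_norm.
Qed.

Lemma dot_unit_le_norm u v : dot u u = 1 -> dot u v <= k%:R * `|v|.
Proof.
move=> u1; apply: le_trans (dot_le_norm _ _) _; rewrite ler_wpM2r//.
apply: (le_trans (ler_sum _ (fun i _ => coord_le1 i u1))).
by rewrite sumr_const card_ord.
Qed.

End Dot.

Lemma enorm_le_dot (R : realType) (k l : nat) (u : 'cV[R]_k) (v : 'cV[R]_l) :
  (enorm u <= enorm v) = (dot u u <= dot v v).
Proof. by rewrite ler_sqrt// dot_ge0. Qed.

(** * The dot product on the product space *)

Definition pdot (R : realType) (n m : nat) (p q : prodspace R n m) : R :=
  dot p.1 q.1 + dot p.2 q.2.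

Section Pdot.
Context {R : realType} {n m : nat}.
Implicit Types p q r : prodspace R n m.

Lemma pdotC p q : pdot p q = pdot q p.
Proof. by rewrite /pdot dotC (dotC p.2). Qed.

Lemma pdotDr p q r : pdot r (p + q) = pdot r p + pdot r q.
Proof. by rewrite /pdot/= !dot_lin addrACA. Qed.

Lemma pdotZr t p q : pdot q (t *: p) = t * pdot q p.
Proof. by rewrite /pdot/= !dot_lin mulrDr. Qed.

Lemma pdotNr p q : pdot q (- p) = - pdot q p.
Proof. by rewrite -scaleN1r pdotZr mulN1r. Qed.

Lemma pdotDl p q r : pdot (p + q) r = pdot p r + pdot q r.
Proof. by rewrite pdotC pdotDr ![pdot r _]pdotC. Qed.

Lemma pdotZl t p q : pdot (t *: p) q = t * pdot p q.
Proof. by rewrite pdotC pdotZr pdotC. Qed.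

Lemma pdotNl p q : pdot (- p) q = - pdot p q.
Proof. by rewrite pdotC pdotNr pdotC. Qed.

Definition pdot_lin := (pdotDl, pdotDr, pdotZl, pdotZr, pdotNl, pdotNr).

Lemma pdot_sumr (I : finType) p (t : I -> R) (s : I -> prodspace R n m) :
  pdot p (\sum_i t i *: s i) = \sum_i t i * pdot p (s i).
Proof.
elim/big_ind2: _ => [|x u y v <- <-|i _]; last by rewrite pdotZr.
  by rewrite -(scale0r p) pdotZr mul0r.
by rewrite pdotDr.
Qed.

Lemma norm_fst p : `|p.1| <= `|p|.
Proof. by rewrite [leRHS]/Num.norm/= le_max lexx. Qed.

Lemma norm_snd p : `|p.2| <= `|p|.
Proof. by rewrite [leRHS]/Num.norm/= le_max lexx orbT. Qed.

Lemma pdot_le_norm p : exists2 c, 0 <= c & forall q, pdot p q <= c * `|q|.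
Proof.
exists (\sum_i `|p.1 i 0| + \sum_i `|p.2 i 0|).
  by rewrite addr_ge0// sumr_ge0.
move=> q; rewrite mulrDl; apply: lerD; apply: le_trans (dot_le_norm _ _) _.
  by rewrite ler_wpM2l ?norm_fst// sumr_ge0.
by rewrite ler_wpM2l ?norm_snd// sumr_ge0.
Qed.

Lemma closed_pdot_le p s : closed [set q | pdot p q <= s].
Proof.
rewrite -[X in closed X]setCK; apply: open_closedC.
rewrite openE => q /= /negP; rewrite -ltNge => sq.
have [c c0 pc] := pdot_le_norm p; have c1 : 0 < c + 1 by rewrite ltr_wpDl.
apply/nbhs_ballP.
exists ((pdot p q - s) / (c + 1)) => /=.
  by rewrite divr_gt0 ?subr_gt0.
move=> r /=; rewrite -ball_normE/= ltr_pdivlMr// => qr.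
apply/negP; rewrite -ltNge.
have := pc (q - r); rewrite !pdot_lin => h.
have := normr_ge0 (q - r); lra.
Qed.

Lemma nbhs_line (U : set (prodspace R n m)) p q :
  nbhs p U -> exists2 t, 0 < t & U (p + t *: q).
Proof.
move=> /nbhs_ballP [e /= e0 eU]; have q0 : 0 < `|q| + 1 by rewrite ltr_wpDl.
exists (e / (`|q| + 1)); first by rewrite divr_gt0.
apply: eU.
rewrite -ball_normE/= opprD addrA subrr add0r normrN normrZ ger0_norm.
  by rewrite mulrAC ltr_pdivrMr// ltr_pM2l// ltrDl.
by rewrite divr_ge0// ltW.
Qed.

End Pdot.

Lemma convex_setE (R : realType) (V : lmodType R) (K : set V) :
  convex_set K <-> forall x y (t : R), 0 <= t -> t <= 1 -> K x -> K y ->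
    K (t *: x + (1 - t) *: y).
Proof.
split => [cK x y t t0 t1 Kx Ky|cK x y t].
  have t01 : 0 <= t <= 1 by rewrite t0.
  have := cK x y (Itv01 t0 t1); rewrite !inE; exact.
rewrite !inE => Kx Ky; apply: cK => //; exact: ge0 || exact: le1.
Qed.

(** * Hyperplanes, affine hulls and strict points *)

Section Hyperplane.
Context {R : realType} {n m : nat}.
Implicit Types (p q u : prodspace R n m) (K : set (prodspace R n m)).

Lemma dim_prodspace : \dim {: prodspace R n m} = (n + m)%N.
Proof.
by rewrite dimvf; transitivity (n * 1 + m * 1)%N => //; rewrite !muln1.
Qed.

Definition pdot_fun u : prodspace R n m -> R^o := pdot u.

Lemma pdot_fun_is_linear u : linear (pdot_fun u).
Proof. by move=> t p q; rewrite /pdot_fun pdotDr pdotZr. Qed.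

HB.instance Definition _ u := GRing.isLinear.Build R (prodspace R n m) R^o _
  (pdot_fun u) (pdot_fun_is_linear u).

Lemma mem_lker_pdot u p : (p \in lker (linfun (pdot_fun u))) = (pdot u p == 0).
Proof. by rewrite memv_ker lfunE. Qed.

Lemma dim_lker_pdot u : pdot u u != 0 ->
  \dim (lker (linfun (pdot_fun u))) = (n + m - 1)%N.
Proof.
move=> u0; have := limg_ker_dim (linfun (pdot_fun u)) fullv.
rewrite capfv dim_prodspace => <-.
suff -> : \dim (limg (linfun (pdot_fun u))) = 1%N by rewrite addnK.
apply/eqP; rewrite eqn_leq lt0n dimv_eq0; apply/andP; split.
  by have := dimvS (subvf (limg (linfun (pdot_fun u)))); rewrite dimvf.
apply: contra u0 => /eqP limg0.
have : linfun (pdot_fun u) u \in limg (linfun (pdot_fun u)).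
  by rewrite memv_img ?memvf.
by rewrite limg0 memv0 lfunE.
Qed.

Lemma aff_hull_pdot u s K : (forall p, K p -> pdot u p = s) ->
  forall p, aff_hull K p -> pdot u p = s.
Proof.
move=> Ks _ [k] [t] [x] [Kx t1 ->]; rewrite pdot_sumr.
by under eq_bigr do rewrite Ks//; rewrite -mulr_suml t1 mul1r.
Qed.

Lemma aff_hull2 K p q (t : R) : K p -> K q ->
  aff_hull K (t *: p + (1 - t) *: q).
Proof.
move=> Kp Kq; exists 2%N, (fun i => if i == ord0 then t else 1 - t).
exists (fun i => if i == ord0 then p else q); split.
- by move=> i; case: ifP.
- by rewrite !big_ord_recl big_ord0/= addr0 addrC subrK.
- by rewrite !big_ord_recl big_ord0/= addr0.
Qed.

(* For a finite combination [x = \sum_i t i *: s i] of points of [K], the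
   witness is [\sum_i `|t i| *: s i]. *)
Definition dominated K x := exists c, forall u,
  (forall p, K p -> pdot u p <= 0) -> `|pdot u x| <= - pdot u c.

Lemma aff_hull_dominated K x : aff_hull K x -> dominated K x.
Proof.
move=> [k] [t] [s] [Ks _ ->]; exists (\sum_i `|t i| *: s i) => u Ku.
rewrite !pdot_sumr (le_trans (ler_norm_sum _ _ _))// -sumrN ler_sum// => i _.
by rewrite normrM (ler0_norm (Ku _ (Ks i))) mulrN.
Qed.

Lemma dominatedD K s t x y :
  dominated K x -> dominated K y -> dominated K (s *: x + t *: y).
Proof.
move=> [c cx] [c' cy]; exists (`|s| *: c + `|t| *: c') => u Ku.
rewrite !pdot_lin (le_trans (ler_normD _ _))// !normrM opprD -!mulrN.
by rewrite lerD// ler_wpM2l// ?cx ?cy.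
Qed.

(** Summing the witnesses of all basis vectors gives one point [c] at which every homogeneous
    inequality valid on [K] has slack at least the l1 norm of its normal. It plays the role of an
    interior point, although [c] need not lie in [K]. *)
Lemma strict_point K : (forall x, dominated K x) -> exists c, forall u,
  (forall p, K p -> pdot u p <= 0) ->
  \sum_i `|u.1 i 0| + \sum_i `|u.2 i 0| <= - pdot u c.
Proof.
move=> domK; have [c1 c1E] := choice (fun i => domK (delta_mx i 0, 0)).
have [c2 c2E] := choice (fun i => domK (0, delta_mx i 0)).
exists (\sum_i 1 *: c1 i + \sum_i 1 *: c2 i) => u Ku.
rewrite pdotDr !pdot_sumr opprD -!sumrN.
have dot_delta k (v : 'cV[R]_k) i : dot v (delta_mx i 0) = v i 0.
  rewrite dotE (bigD1 i)//= big1 ?addr0 ?mxE ?eqxx ?mulr1// => j ji.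
  by rewrite mxE (negPf ji) mulr0.
have dot0 k (v : 'cV[R]_k) : dot v 0 = 0 by rewrite -(scale0r 0) dotZr mul0r.
apply: lerD; apply: ler_sum => i _; rewrite mul1r.
  by have := c1E i u Ku; rewrite /pdot/= dot0 addr0 dot_delta.
by have := c2E i u Ku; rewrite /pdot/= dot0 add0r dot_delta.
Qed.

Lemma full_dim_dominated K x : full_dim K -> dominated K x.
Proof.
move=> [x0 [U [KU dU]]]; apply: aff_hull_dominated; rewrite KU/=.
have /eqP -> : U == fullv by rewrite eqEdim subvf dim_prodspace dU leqnn.
exact: memvf.
Qed.

(** By dimension, the affine hull of [K] is the whole hyperplane where [pdot u] is -1. This
    hyperplane misses the origin, so any [x] is a linear combination of two of its points, and
    domination passes to linear combinations. *)
Lemma full_dim_in_hyperplane_dominated u K x : pdot u u != 0 ->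
  (forall p, K p -> pdot u p = -1) -> has_dim K (n + m - 1) -> dominated K x.
Proof.
move=> u0 Ku [x0 [U [KU dU]]]; have hK := aff_hull_pdot Ku.
have hx0 : aff_hull K x0 by rewrite KU/= subrr mem0v.
have ux0 := hK _ hx0.
have UE : U = lker (linfun (pdot_fun u)).
  apply/eqP; rewrite eqEdim dim_lker_pdot// dU leqnn andbT.
  apply/subvP => w wU; rewrite mem_lker_pdot.
  have : aff_hull K (w + x0) by rewrite KU/= addrK.
  by move=> /hK; rewrite pdotDr ux0 => /eqP; rewrite -subr_eq0 opprK addrNK.
have -> : x = 1 *: (x + (pdot u x + 1) *: x0) + (- (pdot u x + 1)) *: x0.
  by rewrite scale1r scaleNr addrK.
apply: dominatedD; apply: aff_hull_dominated => //.
rewrite KU/= UE mem_lker_pdot !pdot_lin ux0; apply/eqP; ring.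
Qed.

End Hyperplane.

(** * Closed convex cones defined by families of cuts *)

Section Cuts.
Context {R : realType} {n m : nat}.
Context (l : 'cV[R]_m -> prodspace R n m) (I : set 'cV[R]_m).

Definition cuts : set (prodspace R n m) :=
  [set p | forall b, I b -> pdot (l b) p <= 0].

Lemma closed_cuts : closed cuts.
Proof.
rewrite (_ : cuts = \bigcap_(b in I) [set p | pdot (l b) p <= 0]); last first.
  by apply/seteqP; split => p.
by apply: closed_bigI => b _; exact: closed_pdot_le.
Qed.

Lemma cuts_cone p q s t : 0 <= s -> 0 <= t -> cuts p -> cuts q ->
  cuts (s *: p + t *: q).
Proof.
move=> s0 t0 Cp Cq b Ib; rewrite !pdot_lin.
by have := Cp _ Ib; have := Cq _ Ib; nra.
Qed.

Lemma convex_cuts : convex_set cuts.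
Proof.
apply/convex_setE => p q t t0 t1 Cp Cq.
by apply: cuts_cone => //; rewrite subr_ge0.
Qed.

End Cuts.

Lemma unit_direction (R : realType) (m : nat) (y : 'cV[R]_m) : (1 <= m)%N ->
  exists2 b, sphere R m b & y = enorm y *: b.
Proof.
move=> m1; have [y0|y0] := eqVneq (enorm y) 0.
  exists (delta_mx (Ordinal m1) 0).
    apply/sphere_dot; rewrite dotE (bigD1 (Ordinal m1))//= big1 ?addr0.
      by rewrite mxE !eqxx mulr1.
    by move=> i im; rewrite mxE (negPf im) mul0r.
  by rewrite y0 scale0r; apply: dot_eq0; rewrite -sqr_enorm y0 expr0n.
exists ((enorm y)^-1 *: y); last by rewrite scalerA mulfV ?scale1r.
by apply/sphere_dot; rewrite !dot_lin -sqr_enorm; field.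
Qed.

(** By Cauchy-Schwarz the first summand is at least [- (enorm u.1 * enorm p.1)]; the second is
    [enorm p.2 * dot u.2 b], which outweighs it. *)
Lemma pdot_Qh_ge0 (R : realType) (n m : nat) (u p : prodspace R n m) b :
  Qh p -> p.2 = enorm p.2 *: b -> enorm u.1 <= dot u.2 b -> 0 <= pdot u p.
Proof.
rewrite /Qh/= => p12 pb ub.
rewrite /pdot pb dotZr -[X in 0 <= X + _]opprK -dotNl.
rewrite addrC subr_ge0 (le_trans (dot_le_enorm _ _))//.
have -> : enorm (- u.1) = enorm u.1 by rewrite /enorm !dot_lin opprK.
have := enorm_ge0 u.1; have := enorm_ge0 p.1; nra.
Qed.

(** A point of [Qh] satisfies the cut indexed by the direction of its second component at best with
    equality. Were it interior, a small step along [- c] would stay in the set and violate that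
    cut. *)
Lemma Qh_free_cuts (R : realType) (n m : nat) (l : 'cV[R]_m -> prodspace R n m)
  c : (1 <= m)%N ->
  (forall b, sphere R m b -> enorm (l b).1 <= dot (l b).2 b) ->
  (forall b, sphere R m b -> pdot (l b) c < 0) ->
  Qh_free (cuts l (sphere R m)).
Proof.
move=> m1 lb lc; split; [exact: closed_cuts|exact: convex_cuts|].
apply/seteqP; split => // p [Cp Qp].
have [b b1 pb] := unit_direction p.2 m1.
have lp := pdot_Qh_ge0 Qp pb (lb _ b1).
have [t t0 /(_ _ b1)] := nbhs_line (- c) Cp; rewrite !pdot_lin.
have := lc _ b1; nra.
Qed.

(** * Maximality makes [Gamma] nonexpansive *)

Definition Gcut (R : realType) (n m : nat) (Gamma : 'cV[R]_m -> 'cV[R]_n) b :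
  prodspace R n m := (- Gamma b, b).

Section Nonexpansive.
Context {R : realType} {n m : nat}.
Context (Gamma : 'cV[R]_m -> 'cV[R]_n).
Context (hGamma : set_fun (sphere R m) (sphere R n) Gamma).

Lemma pdot_Gcut b p : pdot (Gcut Gamma b) p = - dot (Gamma b) p.1 + dot b p.2.
Proof. by rewrite /pdot/= dotNl. Qed.

Lemma CGammaE I : CGamma Gamma I = cuts (Gcut Gamma) I.
Proof.
by apply/seteqP; split => p Cp b /Cp; rewrite pdot_Gcut.
Qed.

Lemma dot_Gamma b : sphere R m b -> dot (Gamma b) (Gamma b) = 1.
Proof. by move=> /hGamma /sphere_dot. Qed.

Lemma pdot_Gcut_le_norm b p : sphere R m b ->
  pdot (Gcut Gamma b) p <= (n + m)%:R * `|p|.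
Proof.
move=> b1; rewrite natrD mulrDl; apply: lerD.
  apply: (le_trans (dot_unit_le_norm _ _)).
    by rewrite !dot_lin opprK dot_Gamma.
  by rewrite ler_wpM2l ?norm_fst.
apply: (le_trans (dot_unit_le_norm _ _)); first exact/sphere_dot.
by rewrite ler_wpM2l ?norm_snd.
Qed.

(** Both components of [Gcut Gamma b] are unit vectors, and each contributes at least 1 to the
    slack. The resulting bound 2 is uniform in [b], which does the work of a compactness
    argument. *)
Lemma cuts_strict_point K I : I `<=` sphere R m -> K `<=` CGamma Gamma I ->
  (forall x, dominated K x) ->
  exists c, (forall b, I b -> pdot (Gcut Gamma b) c <= - 2) /\
    forall u, (forall p, K p -> pdot u p <= 0) ->
  \sum_i `|u.1 i 0| + \sum_i `|u.2 i 0| <= - pdot u c.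
Proof.
move=> I1 KC /strict_point [c cP]; exists c; split=> // b Ib.
have b1 := I1 _ Ib; rewrite lerNr.
apply: le_trans (cP (Gcut Gamma b) _); last first.
  by move=> p /KC; rewrite CGammaE; exact.
rewrite -[2]/(1 + 1) lerD// sum_norm_unit_ge1//; last exact/sphere_dot.
by rewrite !dot_lin opprK dot_Gamma.
Qed.

(* Otherwise let [z] be the point in question and weaken the cuts that [z]
   violates by at least [M], adding [e] times the cut of [b0], which is tight at
   [z].  As [pdot (Gcut Gamma b) z = dot b b0 - dot (Gamma b) (Gamma b0)], for
   small [e] each weakened cut remains nonnegative on [(x, b)] for all unit [x],
   so the larger set stays free; it contains [z + s *: c], which violates some
   original cut. *)
Lemma maximal_Qh_free_nonexpansive b0 : (1 <= m)%N ->
  full_dim (CGamma Gamma (sphere R m)) ->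
  maximal_Qh_free (CGamma Gamma (sphere R m)) -> sphere R m b0 ->
  CGamma Gamma (sphere R m) (Gamma b0, b0).
Proof.
move=> m1 fC [_ maxC] b01; apply: contrapT => zC.
have [c [c2 _]] := cuts_strict_point (@subset_refl _ _) (@subset_refl _ _)
  (fun x => full_dim_dominated x fC).
set z := (Gamma b0, b0) in zC.
have z0 : pdot (Gcut Gamma b0) z = 0.
  by rewrite pdot_Gcut/= dot_Gamma// (sphere_dot b0).1// addNr.
pose H : R := (n + m)%:R * `|c| + 2.
have H0 : 0 < H by rewrite ltr_wpDl// mulr_ge0.
have cH b : sphere R m b -> - pdot (Gcut Gamma b) c <= H.
  move=> b1; rewrite -pdotNr; apply: (le_trans (pdot_Gcut_le_norm _ b1)).
  by rewrite normrN lerDl.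
(* The line [z + t *: c] meets the boundary of the cut of [b] at [t = kappa b]. *)
pose kappa b := pdot (Gcut Gamma b) z / - pdot (Gcut Gamma b) c.
have h0 b : sphere R m b -> 0 < - pdot (Gcut Gamma b) c.
  by move=> /c2; lra.
have kappaE b : sphere R m b ->
    pdot (Gcut Gamma b) z = kappa b * - pdot (Gcut Gamma b) c.
  by move=> b1; rewrite /kappa divfK// gt_eqF// h0.
have ubE : has_ubound (kappa @` sphere R m).
  exists ((n + m)%:R * `|z|) => _ [b b1 <-].
  rewrite /kappa ler_pdivrMr ?h0// (le_trans (pdot_Gcut_le_norm _ b1))//.
  by rewrite ler_peMr ?mulr_ge0//; have := c2 _ b1; lra.
have supE : has_sup (kappa @` sphere R m) by split=> //; exists (kappa b0), b0.
pose M := sup (kappa @` sphere R m).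
have kM b : sphere R m b -> kappa b <= M.
  by move=> b1; apply: ub_le_sup => //; exists b.
have M0 : 0 < M.
  have /existsNP [b /not_implyP [b1 /negP]] : ~ (forall b, sphere R m b ->
      pdot (Gcut Gamma b) z <= 0) by move=> h; apply: zC; rewrite CGammaE.
  rewrite -ltNge kappaE// pmulr_lgt0 ?h0// => /lt_le_trans; apply.
  exact: kM.
(* The bound [e <= 1] keeps [dot (b + e *: b0) b] nonnegative, and [e <= M] makes it at least the
   length of [Gamma b + e *: Gamma b0] for the weakened cuts. *)
pose e : R := Num.min 1 M.
have e0 : 0 < e by rewrite lt_min ltr01.
have e1 : e <= 1 by rewrite ge_min lexx.
have eM : e <= M by rewrite ge_min lexx orbT.
pose l b := if pdot (Gcut Gamma b) z < M then Gcut Gamma b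
            else Gcut Gamma b + e *: Gcut Gamma b0.
pose C' := cuts l (sphere R m).
have sub : CGamma Gamma (sphere R m) `<=` C'.
  rewrite CGammaE => p Cp b b1; rewrite /l; case: ifP => _; first exact: Cp.
  by rewrite !pdot_lin; have := Cp _ b1; have := Cp _ b01; nra.
have freeC' : Qh_free C'.
  apply: (@Qh_free_cuts _ _ _ l c m1) => b b1; rewrite /l; last first.
    case: ifP => _; first by have := c2 _ b1; lra.
    by rewrite !pdot_lin; have := c2 _ b1; have := c2 _ b01; nra.
  have bb : dot b b = 1 by apply/sphere_dot.
  have b0b0 : dot b0 b0 = 1 by apply/sphere_dot.
  have b0b : -1 <= dot b0 b.
    by have := dot_ge0 (b0 + b); rewrite !dot_lin (dotC b) bb b0b0; lra.
  case: ltP => [_|zb].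
    by rewrite /enorm/= !dot_lin opprK dot_Gamma// sqrtr1 bb.
  move: zb; rewrite pdot_Gcut/= => zb.
  have s0 : 0 <= dot (b + e *: b0) b by rewrite !dot_lin bb; nra.
  (* The squares differ by [e * (2 * (x - y) - e) + (e * x) ^+ 2], where [x - y] is the value of the
     cut of [b] at [z], at least [M]. *)
  rewrite /= -ler_sqr ?nnegrE ?enorm_ge0// sqr_enorm !dot_lin.
  rewrite !dot_Gamma// bb (dotC (Gamma b0)) (dotC b0).
  move: zb; set x := dot b b0; set y := dot _ _ => zb.
  have : 0 <= e * (2 * (x - y) - e) by rewrite mulr_ge0//; lra.
  have := sqr_ge0 (e * x); lra.
have C'C : C' `<=` CGamma Gamma (sphere R m).
  by apply: contrapT => nsub; apply: (maxC _ freeC').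
(* Since [s] is below the supremum [M], the point [z + s *: c] still violates an original cut. The
   excess, at most [(M - s) * H = e * M], is absorbed by the added multiple of the cut of [b0]. *)
pose s := M - e * M / H.
have sM : s < M by rewrite /s ltrBlDr ltrDl divr_gt0// mulr_gt0.
have sH : (M - s) * H = e * M by rewrite /s; field; lra.
have sM2 : M <= s * 2.
  have H2 : 2 <= H by rewrite /H lerDr mulr_ge0.
  have : (M - s) * 2 <= M; last by lra.
  apply: (@le_trans _ _ ((M - s) * H)); first by rewrite ler_pM2l ?subr_gt0.
  by rewrite sH ler_piMl// ltW.
have : C' (z + s *: c).
  move=> b b1; rewrite /l; case: ltP => zb; rewrite !pdot_lin.
    have := c2 _ b1; nra.
  rewrite z0 kappaE//.
  have := kM _ b1; have := cH _ b1; have := c2 _ b1; have := c2 _ b01.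
  set x := pdot _ c; set y := pdot _ c; set k := kappa b => x2 y2 yH kM'.
  have : (k - s) * - y <= (M - s) * H.
    apply: (@le_trans _ _ ((M - s) * - y)); first by apply: ler_wpM2r; lra.
    by apply: ler_wpM2l; lra.
  have : e * (s * x) <= e * (- M) by rewrite ler_pM2l//; nra.
  rewrite sH; lra.
move=> /C'C; rewrite CGammaE => Czs.
have [_ [b b1 <-]] : exists2 k, (kappa @` sphere R m) k & s < k.
  have [|k Ek] := @sup_adherent _ _ (M - s) _ supE; first by rewrite subr_gt0.
  by rewrite -/M opprB addrC subrK; exists k.
have := Czs _ b1; rewrite !pdot_lin kappaE//; have := h0 _ b1; nra.
Qed.

End Nonexpansive.

(** * The slice by the hyperplane, and the forward implication *)

Section Slice.
Context {R : realType} {n m : nat}.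
Context (a : 'cV[R]_n) (d : 'cV[R]_m) (Gamma : 'cV[R]_m -> 'cV[R]_n).
Context (hGamma : set_fun (sphere R m) (sphere R n) Gamma).
Context (a1 : dot a a = 1).
Context (d1 : dot d d < 1).

Lemma near_Gcut_le (p : prodspace R n m) (e : R) : 0 < e ->
  \forall q \near p, forall b, sphere R m b -> pdot (Gcut Gamma b) (q - p) <= e.
Proof.
move=> e0; have c1 : 0 < (n + m)%:R + 1 :> R by rewrite ltr_wpDl.
apply/nbhs_ballP; exists (e / ((n + m)%:R + 1)) => /=.
  by rewrite divr_gt0.
move=> q; rewrite -ball_normE/= ltr_pdivlMr// distrC => pq b b1.
apply: (le_trans (pdot_Gcut_le_norm hGamma _ b1)).
by have := normr_ge0 (q - p); lra.
Qed.

Lemma HplaneE (p : prodspace R n m) : Hplane a d p = (pdot (a, d) p = -1).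
Proof. by []. Qed.

Lemma aff_hull_Hplane (K : set (prodspace R n m)) :
  K `<=` Hplane a d -> aff_hull K `<=` Hplane a d.
Proof. by move=> KH; apply: (@aff_hull_pdot _ _ _ (a, d)). Qed.

Lemma scale_into_Hplane I (c : prodspace R n m) : pdot (a, d) c < 0 ->
  (forall b, I b -> pdot (Gcut Gamma b) c <= - 2) ->
  exists2 k, Hplane a d k & exists2 e, 0 < e &
    forall b, I b -> pdot (Gcut Gamma b) k <= - e.
Proof.
move=> Ac cI; have s0 : 0 < (- pdot (a, d) c)^-1 by rewrite invr_gt0 oppr_gt0.
exists ((- pdot (a, d) c)^-1 *: c).
  by rewrite HplaneE pdotZr; field; rewrite lt_eqF.
exists ((- pdot (a, d) c)^-1 * 2); first by rewrite mulr_gt0.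
by move=> b Ib; rewrite pdotZr -mulrN ler_pM2l// cI.
Qed.

(** One neighbourhood of [k] serves all cuts at once, because the slack [e] and the norm bound on
    cuts are both uniform in [b]. *)
Lemma strict_relint I k e : I `<=` sphere R m -> Hplane a d k -> 0 < e ->
  (forall b, I b -> pdot (Gcut Gamma b) k <= - e) ->
  relint (CGamma Gamma I `&` Hplane a d) k.
Proof.
move=> I1 Hk e0 ke; rewrite CGammaE; split.
  by split=> // b /ke; lra.
apply: filterS (near_Gcut_le k e0) => q qk /aff_hull_Hplane Hq.
split; last by apply: Hq => p [].
move=> b Ib; have := qk _ (I1 _ Ib); have := ke _ Ib.
by rewrite !pdot_lin; lra.
Qed.

Lemma closed_Hplane : closed (Hplane a d : set (prodspace R n m)).
Proof.
rewrite (_ : Hplane a d = [set p | pdot (a, d) p <= -1] `&`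
                          [set p | pdot (- (a, d)) p <= 1]).
  by apply: closedI; exact: closed_pdot_le.
apply/seteqP; split => p /=; rewrite HplaneE pdotNl.
  by move=> ->; rewrite opprK.
by move=> [p1 p2]; lra.
Qed.

Lemma convex_Hplane : convex_set (Hplane a d : set (prodspace R n m)).
Proof.
apply: (convex_setE _).2 => p q t _ _; rewrite !HplaneE.
by rewrite !pdot_lin => -> ->; ring.
Qed.

Lemma exists_quadratic_ge0 (x y g : R) : 0 < g ->
  exists2 t, 0 <= t & 0 <= x + t * y + t ^+ 2 * g.
Proof.
move=> g0; pose t := (`|x| + `|y|) / g + 1.
have t1 : 1 <= t by rewrite lerDr divr_ge0 ?addr_ge0// ltW.
have tg : `|x| + `|y| <= t * g by rewrite mulrDl divfK ?gt_eqF// lerDl; lra.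
exists t; first by lra.
have : t * (`|x| + `|y|) <= t * (t * g) by apply: ler_wpM2l => //; lra.
have := ler_norm (- x); have := ler_norm (- y); rewrite !normrN.
have := normr_ge0 x; have := normr_ge0 y; rewrite expr2; nra.
Qed.

Lemma Gset_eq_sphere :
  (forall b, sphere R m b -> CGamma Gamma (sphere R m) (Gamma b, b)) ->
  let K := CGamma Gamma (Gset Gamma a d) `&` Hplane a d in
  relint K `&` Qg a d = set0 -> full_dim_in_H K ->
  Gset Gamma a d = sphere R m.
Proof.
move=> nonexp K Kfree Kfull; apply/seteqP; split => [b []//|b0 b01].
split => //; rewrite leNgt; apply/negP => A0.
have GS : Gset Gamma a d `<=` sphere R m by move=> b [].
have A1 : pdot (a, d) (a, d) != 0.
  by rewrite /pdot/= a1 gt_eqF// ltr_wpDr// dot_ge0.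
have [c [c2 cP]] := cuts_strict_point hGamma GS (@subIsetl _ _ _)
  (fun x => full_dim_in_hyperplane_dominated x A1
    (fun p (Kp : K p) => Kp.2) Kfull).
(* The functional [pdot (a, d)] is -1 on [K], hence a valid inequality; its slack at [c] is at least
   1 as [a] is a unit vector. *)
have Ac : pdot (a, d) c < 0.
  have := cP (a, d) => /(_ _)/=; have := sum_norm_unit_ge1 a1.
  have : 0 <= \sum_i `|d i 0| by rewrite sumr_ge0.
  move=> d0 sa h; suff : 1 <= - pdot (a, d) c by lra.
  apply: le_trans (h _); first by lra.
  move=> p [_ Hp]; have : pdot (a, d) p = -1 by [].
  by move=> ->; rewrite lerN10.
have [h Hh [e e0 he]] := scale_into_Hplane Ac c2.
set al := dot a (Gamma b0) + dot d b0 in A0.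
have w0 : 0 < 1 - dot d d by rewrite subr_gt0.
(* Chosen so that [al - s * (1 - dot d d) = 0], which is the value of [pdot (a, d)] at [p] below. *)
pose s := al / (1 - dot d d).
have s0 : 0 < s by rewrite divr_gt0.
have sE : s * dot d d = s - al by rewrite /s; field; rewrite gt_eqF.
(* the q-orthogonal projection of [(Gamma b0, b0)] onto [pdot (a, d) _ = 0] *)
pose p : prodspace R n m := (Gamma b0 - s *: a, b0 + s *: d).
have Ap : pdot (a, d) p = 0.
  by rewrite /pdot/= !dot_lin a1 sE /al; ring.
(* The value at [p] is that at [(Gamma b0, b0)], nonpositive by nonexpansiveness, plus [s] times
   [dot a (Gamma b) + dot d b], nonpositive on [G]. *)
have Gp b : Gset Gamma a d b -> pdot (Gcut Gamma b) p <= 0.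
  move=> [b1 Ab]; have := nonexp _ b01; rewrite CGammaE => /(_ _ b1).
  rewrite !pdot_Gcut/= !dot_lin (dotC (Gamma b)) (dotC _ a) (dotC b d); nra.
have qp : dot p.2 p.2 - dot p.1 p.1 = s * al.
  have bb : dot b0 b0 = 1 by apply/sphere_dot.
  rewrite /= !dot_lin a1 sE dot_Gamma// bb (dotC (Gamma b0)) (dotC b0).
  by rewrite /al; ring.
(* Along [h + t *: p] the difference of squared lengths is quadratic in [t] with leading coefficient
   [s * al > 0], so the ray eventually enters [Qh]. *)
clearbody p; have [t t0 tP] := exists_quadratic_ge0 (dot h.2 h.2 - dot h.1 h.1)
  (2 * (dot h.2 p.2 - dot h.1 p.1)) (mulr_gt0 s0 A0).
have Hx : Hplane a d (h + t *: p).
  by rewrite HplaneE !pdot_lin Ap mulr0 addr0; exact: Hh.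
suff : (relint K `&` Qg a d) (h + t *: p) by rewrite Kfree.
split.
  apply: strict_relint GS Hx e0 _ => b Gb.
  by rewrite !pdot_lin; have := he _ Gb; have := Gp _ Gb; nra.
split => //; rewrite /Qh/= enorm_le_dot -subr_ge0.
rewrite -qp in tP; move: tP; congr (0 <= _).
rewrite !dot_lin (dotC p.1) (dotC p.2); ring.
Qed.

(** * The reverse implication, where all cuts belong to [G] *)

Section Reverse.
Context (m1 : (1 <= m)%N).
Context (fullC : full_dim (CGamma Gamma (sphere R m))).
Context (nonexp : forall b, sphere R m b ->
    CGamma Gamma (sphere R m) (Gamma b, b)).
Context (A_le0 : forall b, sphere R m b -> pdot (a, d) (Gamma b, b) <= 0).
Let K := CGamma Gamma (sphere R m) `&` Hplane a d.

(** The cut of [b] at [(- a, d)] equals [pdot (a, d) (Gamma b, b)], so this direction violates no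
    cut, while [pdot (a, d)] is negative on it. Adding a large multiple to a strict point and
    rescaling lands in the hyperplane. *)
Lemma exists_strict_point : exists2 k, Hplane a d k & exists2 e, 0 < e &
  forall b, sphere R m b -> pdot (Gcut Gamma b) k <= - e.
Proof.
have [c [c2 _]] := cuts_strict_point hGamma (@subset_refl _ _)
  (@subset_refl _ _) (fun x => full_dim_dominated x fullC).
pose N : prodspace R n m := (- a, d).
have AN : pdot (a, d) N = dot d d - 1 by rewrite /pdot/= !dot_lin a1 addrC.
have w0 : 0 < 1 - dot d d by rewrite subr_gt0.
pose t := (`|pdot (a, d) c| + 1) / (1 - dot d d).
have t0 : 0 < t by rewrite divr_gt0// ltr_wpDl.
have tE : t * (1 - dot d d) = `|pdot (a, d) c| + 1 by rewrite /t divfK// gt_eqF.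
apply: (@scale_into_Hplane _ (c + t *: N)).
  by rewrite !pdot_lin AN; have := ler_norm (pdot (a, d) c); lra.
move=> b b1; rewrite !pdot_lin; have := c2 _ b1; have := A_le0 b1.
have -> : pdot (Gcut Gamma b) N = pdot (a, d) (Gamma b, b).
  by rewrite /pdot/= !dot_lin opprK dotC (dotC b).
nra.
Qed.

(** Near the strict point [k] the slice fills the hyperplane, so every point of the hyperplane is on
    a line through [k] and a second point of [K]. *)
Lemma slice_full_dim : full_dim_in_H K.
Proof.
have [k Hk [e e0 ke]] := exists_strict_point.
have A1 : pdot (a, d) (a, d) != 0.
  by rewrite /pdot/= a1 gt_eqF// ltr_wpDr// dot_ge0.
exists k, (lker (linfun (pdot_fun (a, d)))); split; last exact: dim_lker_pdot.
have KS (p : prodspace R n m) :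
    (p - k \in lker (linfun (pdot_fun (a, d)))) = (pdot (a, d) p == -1).
  rewrite mem_lker_pdot !pdot_lin.
  by have -> : pdot (a, d) k = -1 by []; rewrite opprK addr_eq0.
apply/seteqP; split => p /=; rewrite KS.
  by move=> /(@aff_hull_Hplane K)/= Hp; apply/eqP/Hp => q [].
move=> /eqP Hp.
have [t t0 tC] : exists2 t, 0 < t & forall b, sphere R m b ->
    pdot (Gcut Gamma b) (t *: (p - k)) <= e.
  have [t t0 tP] := nbhs_line (p - k) (near_Gcut_le k e0).
  by exists t => // b /tP; rewrite addrC addKr.
have Kt : K (k + t *: (p - k)).
  split.
    rewrite CGammaE => b b1; rewrite pdotDr.
    by have := ke _ b1; have := tC _ b1; lra.
  rewrite HplaneE !pdot_lin Hp.
  have -> : pdot (a, d) k = -1 by []; ring.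
have -> : p = t^-1 *: (k + t *: (p - k)) + (1 - t^-1) *: k.
  rewrite scalerDr scalerA mulVf ?gt_eqF// scale1r scalerBl scale1r.
  by rewrite addrC addrA subrK addrC subrK.
have [Kk _] := strict_relint (@subset_refl _ _) Hk e0 ke.
exact: aff_hull2.
Qed.

(** At a point of [Qh] the cut of its own direction is nonnegative; moving slightly away from the
    strict point [k] inside the hyperplane makes it positive, which excludes relative interior
    points. *)
Lemma slice_Qg_free : Qg_free a d K.
Proof.
have [k Hk [e e0 ke]] := exists_strict_point.
split; [by move=> p [] | exact: slice_full_dim | | |].
- apply: closedI closed_Hplane; rewrite CGammaE; exact: closed_cuts.
- apply/convex_setE => p q t t0 t1 [Cp Hp] [Cq Hq]; split.
    have := @convex_cuts _ _ _ (Gcut Gamma) (sphere R m).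
    by rewrite -CGammaE => /convex_setE; exact.
  by move/convex_setE: convex_Hplane; exact.
apply/seteqP; split => // p [[[Cp Hp] nearK] [Qp _]].
have [b b1 pb] := unit_direction p.2 m1.
have lp : 0 <= pdot (Gcut Gamma b) p.
  apply: pdot_Qh_ge0 Qp pb _; have /sphere_dot /= bb := b1.
  by rewrite /enorm/= !dot_lin opprK dot_Gamma// sqrtr1 bb.
have [t t0] := nbhs_line (p - k) nearK.
have Kk : K k by have [] := strict_relint (@subset_refl _ _) Hk e0 ke.
have -> : p + t *: (p - k) = (1 + t) *: p + (1 - (1 + t)) *: k.
  by rewrite opprD addNKr scalerDl scale1r scalerBr scaleNr addrA.
move=> /(_ (aff_hull2 _ _ _)) [//|//|]; rewrite CGammaE => /(_ _ b1).
rewrite !pdot_lin; have := ke _ b1; nra.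
Qed.

Lemma slice_maximal K' : Qg_free a d K' -> K `<=` K' -> K' `<=` K.
Proof.
move=> [K'H _ _ /convex_setE K'conv K'free] KK' z K'z; apply: contrapT => zK.
have Hz : pdot (a, d) z = -1 by exact: K'H.
have [k Hk [e e0 ke]] := exists_strict_point.
have Ak : pdot (a, d) k = -1 by [].
have /existsNP [b /not_implyP [b1 /negP]] : ~ (forall b, sphere R m b ->
    pdot (Gcut Gamma b) z <= 0).
  by move=> h; apply: zK; split; [rewrite CGammaE|exact: K'H].
rewrite -ltNge => z0.
set eta := pdot _ z in z0; pose v : prodspace R n m := (Gamma b, b).
have bk := ke _ b1; set kap := pdot _ k in bk.
have kap0 : kap != 0 by rewrite lt_eqF// (le_lt_trans bk)// oppr_lt0.
(* Adding [tau *: k] to [z] halves the violation of the cut of [b] and in return gives slack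
   [tau * e] in all cuts, which later provides room for a neighbourhood. *)
pose tau := eta / (2 * - kap).
have tau0 : 0 < tau by rewrite divr_gt0//; lra.
have tauE : tau * kap = - (eta / 2) by rewrite /tau; field.
pose w : prodspace R n m := z + tau *: k.
have cw : - dot (Gamma b) w.1 + dot b w.2 = eta / 2.
  by rewrite -pdot_Gcut !pdot_lin -/kap tauE -/eta; lra.
pose Y := dot w.2 w.2 - dot w.1 w.1.
pose del := eta / (`|Y| + 1).
have del0 : 0 < del by rewrite divr_gt0// ltr_wpDl.
have delE : 0 <= eta + del * Y.
  have : del * (`|Y| + 1) = eta.
    by rewrite /del divfK// gt_eqF// ltr_wpDl.
  have := ler_norm (- Y); rewrite normrN; nra.
have Av : pdot (a, d) v <= 0 by exact: A_le0.
(* Here [- s] is the value of [pdot (a, d)] at [v + del *: w], and [- r] its value at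
   [v + (del * tau) *: k]; dividing by [s] and [r] returns to the hyperplane. *)
pose s := - pdot (a, d) v + del * (1 + tau).
have s0 : 0 < s by have := mulr_gt0 del0 tau0; rewrite /s; lra.
pose r := - pdot (a, d) v + del * tau.
have r0 : 0 < r by have := mulr_gt0 del0 tau0; rewrite /r; lra.
pose P : prodspace R n m := s^-1 *: (v + del *: w).
have HP : Hplane a d P.
  rewrite HplaneE !pdot_lin Hz Ak /s; field.
  by move: s0; rewrite /s => /lt0r_neq0.
have nearP : \forall q \near P, Hplane a d q -> K' q.
  have sP x : s * pdot x P = pdot x v + del * (pdot x z + tau * pdot x k).
    by rewrite /P !pdot_lin mulrA mulfV ?gt_eqF// mul1r.
  have dt0 := mulr_gt0 del0 tau0.
  have e'0 : 0 < s^-1 * (del * tau * e).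
    by apply: mulr_gt0; [rewrite invr_gt0|exact: mulr_gt0].
  apply: filterS (near_Gcut_le P e'0) => q qP Hq.
  (* This writes [q] as a convex combination of [z] and [y]. At [q = P] the vector [r *: y] is
     [v + (del * tau) *: k], with slack at least [del * tau * e] in every cut, so [y] stays in [K]
     for [q] near [P]. *)
  pose y : prodspace R n m := r^-1 *: (s *: q - del *: z).
  have Ky : K y.
    split.
      rewrite CGammaE => b' b'1; rewrite !pdot_lin pmulr_rle0 ?invr_gt0//.
      have : s * pdot (Gcut Gamma b') (q - P) <= del * tau * e.
        by rewrite -ler_pdivlMl// qP.
      rewrite pdotDr pdotNr mulrDr mulrN sP.
      have := nonexp b1; rewrite CGammaE => /(_ _ b'1) nv.
      have : del * tau * pdot (Gcut Gamma b') k <= del * tau * - e.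
        by rewrite ler_pM2l// ke.
      move: nv; rewrite -/v; lra.
    rewrite HplaneE !pdot_lin Hz.
    have -> : pdot (a, d) q = -1 by [].
    by rewrite /s /r; field; move: r0; rewrite /r => /lt0r_neq0.
  have -> : q = (del / s) *: z + (1 - del / s) *: y.
    have -> : 1 - del / s = s^-1 * r.
      have -> : r = s - del by rewrite /r /s; ring.
      by field; rewrite gt_eqF.
    rewrite scalerA mulfK ?gt_eqF// scalerBr !scalerA mulVf ?gt_eqF// scale1r.
    by rewrite [del / s]mulrC addrC subrK.
  apply: K'conv => //; [by rewrite divr_ge0// ltW| |exact: KK'].
  by rewrite ler_pdivrMr// mul1r /s; have := mulr_gt0 del0 tau0; lra.
suff : (relint K' `&` Qg a d) P by rewrite K'free.
split.
  split; first exact: (nbhs_singleton nearP).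
  by apply: filterS nearP => q qK' /(aff_hull_Hplane K'H).
split => //; change (enorm P.1 <= enorm P.2); rewrite enorm_le_dot -subr_ge0.
(* The components of [v] have equal length, so only the cross term [2 * del * (eta / 2)] and the
   term [del ^+ 2 * Y] remain; [del] was taken small enough for the first to dominate. *)
suff -> : dot P.2 P.2 - dot P.1 P.1 = s^-1 * s^-1 * (del * (eta + del * Y)).
  by rewrite !mulr_ge0// ?invr_ge0 ltW.
rewrite /P /Y; move: (w) cw => w' cw.
have bb : dot b b = 1 by apply/sphere_dot.
have -> : eta = 2 * (- dot (Gamma b) w'.1 + dot b w'.2) by rewrite cw; field.
rewrite /= !dot_lin bb dot_Gamma// (dotC w'.1 (Gamma b)) (dotC w'.2 b); ring.
Qed.

End Reverse.
End Slice.

Unset Implicit Arguments.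

Theorem theorem5 (R : realType) (n m : nat) (hn : (1 <= n)%N) (hm : (1 <= m)%N)
    (a : 'cV[R]_n) (d : 'cV[R]_m)
    (hmax : Num.max (enorm a) (enorm d) = 1)
    (hda : enorm d < enorm a) (ha : enorm a = 1)
    (Gamma : 'cV[R]_m -> 'cV[R]_n)
    (hGamma : set_fun (sphere R m) (sphere R n) Gamma)
    (hfull : full_dim (CGamma Gamma (sphere R m)))
    (hmaximal : maximal_Qh_free (CGamma Gamma (sphere R m))) :
  let G := Gset Gamma a d in
  let K := CGamma Gamma G `&` Hplane a d in
  (full_dim_in_H K /\ maximal_Qg_free a d K) <-> G = sphere R m.
Proof.
move=> G K.
have a1 : dot a a = 1 by rewrite -sqr_enorm ha expr1n.
have d1 : dot d d < 1.
  by rewrite -sqr_enorm expr_lt1 ?enorm_ge0// -ha.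
have nonexp b :=
  @maximal_Qh_free_nonexpansive _ _ _ _ hGamma b hm hfull hmaximal.
split => [[Kfull [[_ _ _ _ Kfree] _]]|GS].
  exact: Gset_eq_sphere hGamma a1 d1 nonexp Kfree Kfull.
have A_le0 b : sphere R m b -> pdot (a, d) (Gamma b, b) <= 0.
  by rewrite -GS => -[].
rewrite /K GS; split.
  exact: slice_full_dim hGamma a1 d1 hfull A_le0.
split; first exact: slice_Qg_free hGamma a1 d1 hm hfull A_le0.
move=> K' K'free [KK' nK'K]; apply: nK'K.
exact: slice_maximal hGamma a1 d1 hfull nonexp A_le0 _ K'free KK'.
Qed.
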